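(* Let $G$ be a finite simple undirected graph on the vertex set $\{1,\ldots,n\}$ with at least one edge, let $A$ be its adjacency matrix, and let $\chi$ be its chromatic number. Then $$\chi\;\ge\;\max_W\left\{\frac{S^+(W*A)}{S^-(W*A)}\right\},$$ where $W$ ranges over all self-adjoint complex $n\times n$ matrices with $W*A\ne 0$, $S^+(W*A)$ is the sum of the squares of the positive eigenvalues of the Schur product $W*A$, and $S^-(W*A)$ is the sum of the squares of the negative eigenvalues of $W*A$ (eigenvalues counted with multiplicity).
   Context: The adjacency matrix of $G$ is the $n\times n$ matrix $A=(a_{k\ell})$ with $a_{k\ell}=1$ if $(k,\ell)$ is an edge and $a_{k\ell}=0$ otherwise. The Schur product $W*A$ is the entrywise product, $(W*A)_{k\ell}=w_{k\ell}a_{k\ell}$. The chromatic number $\chi$ is the least $c$ for which there is a map $\Phi:\{1,\ldots,n\}\to\{1,\ldots,c\}$ with $\Phi(k)\ne\Phi(\ell)$ whenever $a_{k\ell}=1$. *)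

(* Defs.v *)
From HB Require Import structures.
From mathcomp Require Import all_boot all_order all_algebra.
From mathcomp Require Import complex.
From mathcomp Require Import boolp classical_sets reals.

Set Implicit Arguments.
Unset Strict Implicit.
Unset Printing Implicit Defensive.

Import Order.TTheory GRing.Theory Num.Theory.
Local Open Scope ring_scope.
Local Open Scope complex_scope.
Local Open Scope classical_set_scope.

Record simple_graph (n : nat) := SimpleGraph {
  edge :> rel 'I_n;
  edge_sym : symmetric edge;
  edge_irrefl : irreflexive edge
}.

Definition colorable n (G : simple_graph n) (c : nat) : bool :=
  [exists Phi : {ffun 'I_n -> 'I_c},
    [forall k, forall l, G k l ==> (Phi k != Phi l)]].

Lemma colorable_ex n (G : simple_graph n) : exists c, colorable G c.
Proof.
exists n; apply/existsP; exists [ffun k => k].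
apply/forallP => k; apply/forallP => l; apply/implyP => Gkl.
by rewrite !ffunE; apply: contraTneq Gkl => ->; rewrite edge_irrefl.
Qed.

Definition chromatic_number n (G : simple_graph n) : nat :=
  ex_minn (colorable_ex G).

Definition adjmx (C : pzSemiRingType) n (G : simple_graph n) : 'M[C]_n :=
  \matrix_(k, l) (G k l)%:R.

Definition schur_mul (C : pzSemiRingType) m n (W A : 'M[C]_(m, n)) :
  'M[C]_(m, n) := map2_mx *%R W A.

(* The roots of the characteristic polynomial, each repeated according to its
   multiplicity, in an unspecified order. *)
Definition eigenvalues (C : closedFieldType) n (M : 'M[C]_n) : seq C :=
  sval (closed_field_poly_normal (char_poly M)).

(* In the partial order of R[i], [0 < x] means that x is real and positive (and
   similarly for [x < 0]), so that taking the real part loses nothing. *)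
Definition Splus (R : realType) n (M : 'M[R[i]]_n) : R :=
  \sum_(x <- eigenvalues M | 0 < x) complex.Re x ^+ 2.

Definition Sminus (R : realType) n (M : 'M[R[i]]_n) : R :=
  \sum_(x <- eigenvalues M | x < 0) complex.Re x ^+ 2.

Definition admissible (R : realType) n (G : simple_graph n) : set 'M[R[i]]_n :=
  [set W | W \is hermsymmx /\ schur_mul W (adjmx R[i] G) != 0].

Definition eig_ratio (R : realType) n (G : simple_graph n) (W : 'M[R[i]]_n) : R :=
  let M := schur_mul W (adjmx R[i] G) in Splus M / Sminus M.

Definition is_maximum (R : realType) (E : set R) (m : R) : Prop :=
  E m /\ ubound E m.

(* Main.v *)
Require Import Defs.
From HB Require Import structures.
From mathcomp Require Import all_boot all_order all_algebra.
From mathcomp Require Import complex.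
From mathcomp Require Import ring lra.
From mathcomp Require Import boolp classical_sets reals.
From mathcomp Require Import topology normedtype derive.

Set Implicit Arguments.
Unset Strict Implicit.
Unset Printing Implicit Defensive.

Import Order.TTheory GRing.Theory Num.Theory.
Import numFieldNormedType.Exports.
Local Open Scope ring_scope.
Local Open Scope complex_scope.
Local Open Scope classical_set_scope.
Local Open Scope sesquilinear_scope.

(** Write [|X|^2] for the squared Frobenius norm, [H] for the conjugate
    transpose, and [P o A] for the restriction of a matrix [P] to the edges of
    the graph.  Positive semidefinite matrices are handled as Gram matrices
    [P = Q Q^H].

    Everything rests on a variational description of the negative eigenvalues:
    [S^-(M)] is the squared distance from the Hermitian matrix [M] to the cone
    of Gram matrices ([Sminus_le_dist]), and this distance is reached at the
    positive part of [M], whose squared norm is [S^+(M)] ([positive_part]).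

    Let [sigma] be the minimum of [|P - P o A|^2 / |P|^2] over the nonzero Gram
    matrices [P].  Being scale invariant and continuous in [Q], this ratio can
    be minimized over the compact unit sphere, so that [sigma] is attained
    ([gram_ratio_min]).  For [M] Hermitian and supported on the edges,
    [S^-(M) >= sigma |M|^2], by the Cauchy-Schwarz inequality applied to [M] and
    to the restriction of its positive part ([Sminus_ge]).  Conversely, if [P]
    attains [sigma], then [M = P o A] satisfies [S^-(M) <= sigma |M|^2], because
    [(1 - sigma) P] is a Gram matrix at squared distance [sigma |M|^2] from [M]
    ([Sminus_le_witness]).  As [S^+(M) + S^-(M) = |M|^2], the ratio [S^+ / S^-]
    has maximum [1 / sigma - 1], and [W = P] realizes it.

    Finally a colouring with [c] colours gives [sigma >= 1 / c]
    ([frob_gram_le_colors]): the diagonal blocks of [P] along the colour classes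
    avoid the edges, hence survive in [P - P o A], and they carry at least the
    fraction [1 / c] of [|P|^2].  So the maximum is at most [c - 1]. *)

(** * The Frobenius inner product *)

(** The real part of the Hermitian inner product: this is the Euclidean inner
    product of the underlying real vector space. *)
Definition fdot (R : realType) m n (X Y : 'M[R[i]]_(m, n)) : R :=
  \sum_i \sum_j (complex.Re (X i j) * complex.Re (Y i j) +
                 complex.Im (X i j) * complex.Im (Y i j)).

Definition frob (R : realType) m n (X : 'M[R[i]]_(m, n)) : R := fdot X X.

Lemma fdot_tr (R : realType) m n (X Y : 'M[R[i]]_(m, n)) :
  fdot X Y = complex.Re (\tr (X *m Y^t*)).
Proof.
rewrite /mxtrace raddf_sum; apply: eq_bigr => i _.
rewrite mxE raddf_sum; apply: eq_bigr => j _; rewrite !mxE.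
by case: (X i j) (Y i j) => [a b] [c d] /=; ring.
Qed.

Lemma frob_ge_entries (R : realType) m n (X : 'M[R[i]]_(m, n)) :
  forall i j, complex.Re (X i j) ^+ 2 + complex.Im (X i j) ^+ 2 <= frob X.
Proof.
move=> i j; rewrite /frob /fdot (bigD1 i) //= (bigD1 j) //= -!expr2 -addrA.
rewrite lerDl.
apply: addr_ge0; do ![apply: sumr_ge0 => ? _];
  by rewrite addr_ge0 // -expr2 sqr_ge0.
Qed.

Lemma frob_ge0 (R : realType) m n (X : 'M[R[i]]_(m, n)) : 0 <= frob X.
Proof.
by do 2![apply: sumr_ge0 => ? _]; rewrite addr_ge0 // -expr2 sqr_ge0.
Qed.

Lemma frob_eq0 (R : realType) m n (X : 'M[R[i]]_(m, n)) :
  (frob X == 0) = (X == 0).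
Proof.
apply/eqP/eqP => [X0|->]; last first.
  by rewrite /frob fdot_tr mul0mx mxtrace0.
apply/matrixP => i j; rewrite mxE; apply/eqP; rewrite eq_complex /=.
have := frob_ge_entries X i j; rewrite X0 => le0.
have := sqr_ge0 (complex.Re (X i j)); have := sqr_ge0 (complex.Im (X i j)).
move=> im_ge0 re_ge0; rewrite -[_ == _]sqrf_eq0 -[X in _ && X]sqrf_eq0.
by apply/andP; split; apply/eqP; lra.
Qed.

Lemma frob_lincomb (R : realType) m n (a b : R) (X Y : 'M[R[i]]_(m, n)) :
  frob (a%:C *: X - b%:C *: Y) =
    a ^+ 2 * frob X - 2 * a * b * fdot X Y + b ^+ 2 * frob Y.
Proof.
rewrite /frob /fdot !mulr_sumr -sumrB -big_split; apply: eq_bigr => i _.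
rewrite !mulr_sumr -sumrB -big_split; apply: eq_bigr => j _; rewrite !mxE.
by case: (X i j) (Y i j) => [x x'] [y y'] /=; ring.
Qed.

Lemma frobZ (R : realType) m n (a : R) (X : 'M[R[i]]_(m, n)) :
  frob (a%:C *: X) = a ^+ 2 * frob X.
Proof.
by have := frob_lincomb a 0 X 0; rewrite scaler0 subr0 => ->; ring.
Qed.

Lemma frobB (R : realType) m n (X Y : 'M[R[i]]_(m, n)) :
  frob (X - Y) = frob X - 2 * fdot X Y + frob Y.
Proof. by have := frob_lincomb 1 1 X Y; rewrite !scale1r => ->; ring. Qed.

Lemma trmxC_mul (R : realType) m n p (X : 'M[R[i]]_(m, n)) (Y : 'M_(n, p)) :
  (X *m Y)^t* = Y^t* *m X^t*.
Proof. by rewrite trmx_mul map_mxM. Qed.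

(** The two Gram matrices of [X] have the same nonzero spectrum; at the level of
    norms this is cyclicity of the trace. *)
Lemma frob_mulmx_trmxC (R : realType) m n (X : 'M[R[i]]_(m, n)) :
  frob (X *m X^t*) = frob (X^t* *m X).
Proof.
by rewrite /frob !fdot_tr !trmxC_mul trmxCK -mulmxA mxtrace_mulC -!mulmxA.
Qed.

Lemma frob_unitary_conj (R : realType) n (U X : 'M[R[i]]_n) :
  U \is unitarymx -> frob (U^t* *m X *m U) = frob X.
Proof.
move=> /unitarymxP UU; rewrite /frob !fdot_tr !trmxC_mul trmxCK.
rewrite -!mulmxA mxtrace_mulC !mulmxA.
by rewrite -[_ *m U *m _]mulmxA UU mulmx1 -[_ *m U *m _]mulmxA UU mulmx1.
Qed.

Lemma fdotC (R : realType) m n (X Y : 'M[R[i]]_(m, n)) : fdot X Y = fdot Y X.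
Proof. by apply: eq_bigr => i _; apply: eq_bigr => j _; ring. Qed.

Lemma fdot_suml (R : realType) m n (I : finType)
    (X : I -> 'M[R[i]]_(m, n)) (Y : 'M_(m, n)) :
  fdot (\sum_a X a) Y = \sum_a fdot (X a) Y.
Proof.
rewrite fdot_tr mulmx_suml (raddf_sum (@mxtrace _ _)) raddf_sum.
by apply: eq_bigr => a _; rewrite fdot_tr.
Qed.

(** The square of a sum of [N] terms is at most [N] times the sum of the
    squares: expand the square and bound each cross term by the arithmetic
    mean. *)
Lemma frob_sum_le (R : realType) m n (I : finType) (X : I -> 'M[R[i]]_(m, n)) :
  frob (\sum_a X a) <= #|I|%:R * \sum_a frob (X a).
Proof.
rewrite /frob fdot_suml.
have le_mean a b : fdot (X a) (X b) <= (frob (X a) + frob (X b)) / 2.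
  by have := frob_ge0 (X a - X b); rewrite frobB; lra.
apply: (@le_trans _ _ (\sum_a \sum_b (frob (X a) + frob (X b)) / 2)).
  apply: ler_sum => a _; rewrite fdotC fdot_suml.
  by apply: ler_sum => b _; rewrite fdotC.
under eq_bigr => a _ do rewrite -mulr_suml big_split /= sumr_const.
rewrite -mulr_suml big_split /= sumr_const sumrMnl -mulr_natl.
by lra.
Qed.

(** * Negative eigenvalues as a distance to the Gram matrices *)

Lemma unitarymx_trmxCmul (R : realType) n (U : 'M[R[i]]_n) :
  U \is unitarymx -> U^t* *m U = 1%:M.
Proof. by move=> Uu; rewrite -invmx_unitary // mulVmx // unitarymx_unit. Qed.

Lemma char_poly_unitary_conj (R : realType) n (U M : 'M[R[i]]_n) :
  U \is unitarymx -> char_poly (U^t* *m M *m U) = char_poly M.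
Proof.
move=> /unitarymx_trmxCmul UU.
rewrite /char_poly /char_poly_mx !map_mxM /=.
set V := map_mx polyC _; set W := map_mx polyC U.
have VW : V *m W = 1%:M by rewrite -map_mxM UU map_mx1.
have -> : 'X%:M - V *m map_mx polyC M *m W =
    V *m ('X%:M - map_mx polyC M) *m W.
  by rewrite mulmxBr mulmxBl mul_mx_scalar -scalemxAl VW scalemx1.
by rewrite !det_mulmx mulrAC -det_mulmx VW det1 mul1r.
Qed.

(** The spectral theorem with real eigenvalues [d], identified with the roots of
    the characteristic polynomial: this turns the sums over [eigenvalues] into
    sums over the index set. *)
Lemma spectral_real (R : realType) n (M : 'M[R[i]]_n) : M \is hermsymmx ->
  exists (U : 'M[R[i]]_n) (d : 'I_n -> R),
  [/\ U \is unitarymx, M = U^t* *m diag_mx (\row_i (d i)%:C) *m U &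
      perm_eq (eigenvalues M) [seq (d i)%:C | i <- enum 'I_n]].
Proof.
move=> Mh; have /hermitian_normalmx /orthomx_spectralP Meq := Mh.
have /mxOverP dreal := hermitian_spectral_diag_real Mh.
have Uu := spectral_unitarymx M.
exists (spectralmx M), (fun i => complex.Re (spectral_diag M 0 i)).
have dE : \row_i (complex.Re (spectral_diag M 0 i))%:C = spectral_diag M.
  by apply/rowP => i; rewrite mxE RRe_real.
rewrite dE; rewrite invmx_unitary // in Meq; split=> //.
apply: prod_XsubC_eq; rewrite big_map big_enum /=.
rewrite /eigenvalues; case: closed_field_poly_normal => s /= sE.
rewrite (monicP (char_poly_monic M)) scale1r in sE; rewrite -sE.
rewrite [in LHS]Meq char_poly_unitary_conj // char_poly_trig.
  by apply: eq_bigr => i _; rewrite mxE eqxx mulr1n RRe_real.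
exact: diag_mx_is_trig.
Qed.

Lemma frob_diag (R : realType) n (d : 'I_n -> R) :
  frob (diag_mx (\row_i (d i)%:C)) = \sum_i d i ^+ 2.
Proof.
apply: eq_bigr => i _; rewrite (bigD1 i) //= big1 => [|j ji].
  by rewrite !mxE eqxx mulr1n /=; ring.
by rewrite !mxE eq_sym (negbTE ji) mulr0n /= !mul0r addr0.
Qed.

Lemma frob_ge_diag (R : realType) n (X : 'M[R[i]]_n) :
  \sum_i complex.Re (X i i) ^+ 2 <= frob X.
Proof.
apply: ler_sum => i _; rewrite (bigD1 i) //= -!expr2 -addrA lerDl.
rewrite addr_ge0 ?sqr_ge0 // sumr_ge0 // => j _.
by rewrite addr_ge0 // -expr2 sqr_ge0.
Qed.

Lemma Splus_diag (R : realType) n (M : 'M[R[i]]_n) (d : 'I_n -> R) :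
  perm_eq (eigenvalues M) [seq (d i)%:C | i <- enum 'I_n] ->
  Splus M = \sum_i Num.max (d i) 0 ^+ 2.
Proof.
move=> eigM; rewrite /Splus (perm_big _ eigM) /= big_map big_enum_cond /=.
rewrite big_mkcond; apply: eq_bigr => i _; rewrite ltcR.
by case: (ltrP 0 (d i)) => //= _; rewrite expr0n.
Qed.

Lemma Sminus_diag (R : realType) n (M : 'M[R[i]]_n) (d : 'I_n -> R) :
  perm_eq (eigenvalues M) [seq (d i)%:C | i <- enum 'I_n] ->
  Sminus M = \sum_i Num.min (d i) 0 ^+ 2.
Proof.
move=> eigM; rewrite /Sminus (perm_big _ eigM) /= big_map big_enum_cond /=.
rewrite big_mkcond; apply: eq_bigr => i _; rewrite ltcR.
by case: (ltrP (d i) 0) => //= _; rewrite expr0n.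
Qed.

Lemma Re_gram_diag_ge0 (R : realType) m n (Q : 'M[R[i]]_(m, n)) i :
  0 <= complex.Re ((Q *m Q^t*) i i).
Proof.
rewrite mxE raddf_sum sumr_ge0 // => k _; rewrite !mxE.
by case: (Q i k) => a b /=; have := sqr_ge0 a; have := sqr_ge0 b; nra.
Qed.

(** The one-dimensional case of [Sminus_le_dist]. *)
Lemma min_sqr_le (R : realType) (a p : R) :
  0 <= p -> Num.min a 0 ^+ 2 <= (a - p) ^+ 2.
Proof.
move=> p0; case: (ltrP a 0) => a0; last by rewrite expr0n sqr_ge0.
have : 0 <= p * (p - a) by apply: mulr_ge0; lra.
have : 0 <= p * - a by apply: mulr_ge0; lra.
by lra.
Qed.

(** In an orthonormal eigenbasis of [M] the Gram matrix has nonnegative diagonal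
    entries, and the diagonal of the difference alone already contributes at
    least [S^-(M)]. *)
Lemma Sminus_le_dist (R : realType) m n (M : 'M[R[i]]_n) (Q : 'M_(n, m)) :
  M \is hermsymmx -> Sminus M <= frob (M - Q *m Q^t*).
Proof.
move=> /spectral_real [U [d [Uu ME eigM]]]; rewrite (Sminus_diag eigM).
have UU := unitarymx_trmxCmul Uu.
have -> : M - Q *m Q^t* =
    U^t* *m (diag_mx (\row_i (d i)%:C) - (U *m Q) *m (U *m Q)^t*) *m U.
  rewrite mulmxBr mulmxBl -ME trmxC_mul !mulmxA UU mul1mx.
  by rewrite -!mulmxA UU mulmx1.
rewrite frob_unitary_conj //; apply: le_trans (frob_ge_diag _).
apply: ler_sum => i _; have := Re_gram_diag_ge0 (U *m Q) i.
move: (U *m Q *m _) => P p0; rewrite !mxE eqxx mulr1n.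
rewrite raddfB; exact: min_sqr_le.
Qed.

(** The Gram matrix produced here is the positive part of [M], obtained by
    truncating the eigenvalues at zero; [Q] is an eigenbasis scaled by the
    square roots of the truncated eigenvalues. *)
Lemma positive_part (R : realType) n (M : 'M[R[i]]_n) : M \is hermsymmx ->
  Splus M + Sminus M = frob M /\
  exists Q : 'M[R[i]]_n, frob (Q *m Q^t*) = Splus M /\
    frob (M - Q *m Q^t*) = Sminus M.
Proof.
move=> /spectral_real [U [d [Uu ME eigM]]].
rewrite (Splus_diag eigM) (Sminus_diag eigM); split.
  rewrite ME frob_unitary_conj // frob_diag -big_split.
  apply: eq_bigr => i _ /=.
  by case: (ltrgtP (d i) 0) => h; rewrite ?h; ring.
pose D : 'M[R[i]]_n := diag_mx (\row_i (Num.sqrt (Num.max (d i) 0))%:C).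
have DD : D *m D^t* = diag_mx (\row_i (Num.max (d i) 0)%:C).
  rewrite tr_diag_mx map_diag_mx mulmx_diag; congr diag_mx.
  apply/rowP => i; rewrite !mxE.
  rewrite [X in _ * X](conjc_real _) -rmorphM -expr2 sqr_sqrtr //.
  by rewrite le_max lexx orbT.
have QQ : (U^t* *m D) *m (U^t* *m D)^t* =
    U^t* *m diag_mx (\row_i (Num.max (d i) 0)%:C) *m U.
  by rewrite trmxC_mul trmxCK -DD !mulmxA.
exists (U^t* *m D); rewrite QQ frob_unitary_conj // frob_diag; split=> //.
rewrite ME -mulmxBl -mulmxBr frob_unitary_conj //.
have -> : diag_mx (\row_i (d i)%:C) - diag_mx (\row_i (Num.max (d i) 0)%:C) =
    diag_mx (\row_i (d i - Num.max (d i) 0)%:C).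
  by rewrite -raddfB; congr diag_mx; apply/rowP => i; rewrite !mxE rmorphB.
rewrite frob_diag; apply: eq_bigr => i _.
by case: (ltrgtP (d i) 0) => h; rewrite ?h; ring.
Qed.

(** * Restriction to the edges, and colourings *)

Lemma schur_adjE (R : realType) n (G : simple_graph n) (W : 'M[R[i]]_n) k l :
  schur_mul W (adjmx R[i] G) k l = if G k l then W k l else 0.
Proof. by rewrite !mxE; case: (G k l); rewrite ?mulr1 ?mulr0. Qed.

(** A matrix supported on the edges only sees the restriction of [P] to the
    edges: restriction is an orthogonal projection. *)
Lemma fdot_schur_adj (R : realType) n (G : simple_graph n) (W P : 'M[R[i]]_n) :
  fdot (schur_mul W (adjmx R[i] G)) P =
  fdot (schur_mul W (adjmx R[i] G)) (schur_mul P (adjmx R[i] G)).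
Proof.
apply: eq_bigr => k _; apply: eq_bigr => l _; rewrite !schur_adjE.
by case: (G k l); rewrite //= !mul0r.
Qed.

Lemma frob_off_adj (R : realType) n (G : simple_graph n) (P : 'M[R[i]]_n) :
  frob (P - schur_mul P (adjmx R[i] G)) =
  frob P - frob (schur_mul P (adjmx R[i] G)).
Proof. by rewrite frobB fdotC fdot_schur_adj -/(frob _); ring. Qed.

Lemma schur_adj_herm (R : realType) n (G : simple_graph n) (W : 'M[R[i]]_n) :
  W \is hermsymmx -> schur_mul W (adjmx R[i] G) \is hermsymmx.
Proof.
rewrite !is_hermitianmxE !expr0 !scale1r => /eqP Wh; apply/eqP/matrixP => k l.
rewrite schur_adjE mxE [X in Num.conj X]mxE schur_adjE edge_sym.
by case: (G l k); rewrite ?rmorph0 // [in LHS]Wh !mxE.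
Qed.

Lemma gram_herm (R : realType) m n (Q : 'M[R[i]]_(m, n)) :
  Q *m Q^t* \is hermsymmx.
Proof. by rewrite is_hermitianmxE expr0 scale1r trmxC_mul trmxCK. Qed.

(** Let [Qc a] keep the rows of [Q] coloured [a].  Then [Q^H Q] is the sum of
    the [(Qc a)^H (Qc a)], so [frob_sum_le] applies with one term per colour; and
    [|(Qc a)^H (Qc a)|] is the norm of [(Qc a) (Qc a)^H], the diagonal block of
    [Q Q^H] on the colour class [a], which contains no edge. *)
Lemma frob_gram_le_colors (R : realType) m n c (G : simple_graph n)
    (Phi : 'I_n -> 'I_c) (Q : 'M[R[i]]_(n, m)) :
  (forall k l, G k l -> Phi k != Phi l) ->
  frob (Q *m Q^t*) <=
    c%:R * frob (Q *m Q^t* - schur_mul (Q *m Q^t*) (adjmx R[i] G)).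
Proof.
move=> PhiG; pose Qc a := \matrix_(k, l) if Phi k == a then Q k l else 0.
have sumQc : Q^t* *m Q = \sum_a (Qc a)^t* *m Qc a.
  apply/matrixP => k l; rewrite summxE mxE.
  rewrite (partition_big Phi xpredT) //=; apply: eq_bigr => a _.
  rewrite mxE big_mkcond; apply: eq_bigr => r _; rewrite !mxE.
  by case: (Phi r == a); rewrite ?mulr0.
have QcE a k l : (Qc a *m (Qc a)^t*) k l =
    if (Phi k == a) && (Phi l == a) then (Q *m Q^t*) k l else 0.
  rewrite !mxE; case: ifP => [/andP[ka la]|kla].
    by apply: eq_bigr => r _; rewrite !mxE ka la.
  rewrite big1 // => r _; rewrite !mxE.
  by move: kla; do 2![case: eqP => _] => //; rewrite ?rmorph0 ?mul0r ?mulr0.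
rewrite frob_mulmx_trmxC sumQc; apply: le_trans (frob_sum_le _) _.
rewrite card_ord ler_wpM2l //; move: (Q *m Q^t*) QcE => P QcE.
under eq_bigr => a _ do rewrite -frob_mulmx_trmxC.
rewrite /frob /fdot exchange_big; apply: ler_sum => k _.
rewrite exchange_big; apply: ler_sum => l _ /=; rewrite mxE [X in P k l + X]mxE.
rewrite schur_adjE (bigD1 (Phi k)) //= big1 => [|a /negbTE ak]; last first.
  by rewrite QcE eq_sym ak /= !mul0r addr0.
rewrite QcE eqxx /= addr0; case: ifP => [/eqP kl|_].
  by case: ifP => [/PhiG|_]; rewrite ?kl ?eqxx // subr0.
by rewrite /= !mul0r addr0 addr_ge0 // -expr2 sqr_ge0.
Qed.

(** * Attaining the minimal ratio *)

Lemma continuous_sum (R : realType) (T : topologicalType) (I : finType)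
    (F : I -> T -> R) :
  (forall a, continuous (F a)) -> continuous (fun x => \sum_a F a x).
Proof.
move=> Fc; apply: continuous_big => [|a _]; last exact: Fc.
exact: add_continuous.
Qed.

Lemma continuous_mul (R : realType) (T : topologicalType) (f g : T -> R) :
  continuous f -> continuous g -> continuous (fun x => f x * g x).
Proof. by move=> fc gc x; apply: (@continuousM _ _ f g x (fc x) (gc x)). Qed.

Lemma coord_cont (R : realType) (I : finType) (a : I) :
  continuous (fun x : {ptws I -> R} => x a).
Proof. exact: (@proj_continuous I (fun=> R) a). Qed.

(** The coordinates carry the product topology, so that Tychonoff's theorem
    gives compactness for any finite index type. *)
Definition unit_sphere (R : realType) (I : finType) : set {ptws I -> R} :=
  [set x | \sum_a x a * x a = 1].

Lemma unit_sphere_compact (R : realType) (I : finType) :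
  compact (@unit_sphere R I).
Proof.
have sum_cont : continuous (fun x : {ptws I -> R} => \sum_a x a * x a).
  by apply: continuous_sum => a; apply: continuous_mul; exact: coord_cont.
apply: (@subclosed_compact _ _
  [set x : {ptws I -> R} | forall a, `[-1, 1] (x a)]).
- have /continuous_closedP := sum_cont.
  by move/(_ _ (@closed_eq R 1)).
- apply: (@tychonoff I (fun=> R) (fun=> `[-1, 1])) => a; exact: segment_compact.
- move=> x x1 a; rewrite /= in_itv /= -ler_norml -(@expr_le1 _ 2) //.
  rewrite real_normK ?num_real // -x1 (bigD1 a) //= -expr2 lerDl.
  by apply: sumr_ge0 => b _; rewrite -expr2 sqr_ge0.
Qed.

(** The minimum is stated without a quotient on the right, which makes it
    homogeneous: it then extends from the sphere to all arguments. *)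
Lemma unit_sphere_ratio_min (R : realType) (I : finType)
    (f g : {ptws I -> R} -> R) :
  I -> continuous f -> continuous g -> (forall x, unit_sphere x -> 0 < g x) ->
  exists2 x, unit_sphere x & forall y, unit_sphere y -> f x / g x * g y <= f y.
Proof.
move=> a0 fc gc g0.
have [||x xS xmin] := @compact_EVT_min {ptws I -> R} R
    (fun x => f x / g x) (@unit_sphere R I) _ (@unit_sphere_compact R I).
- exists (fun a => (a == a0)%:R).
  rewrite /unit_sphere /= (bigD1 a0) //= eqxx mulr1.
  by rewrite big1 ?addr0 // => a /negbTE ->; rewrite mulr0.
- apply: continuous_in_subspaceT => x /set_mem /g0 gx.
  apply: (@continuousM _ _ f (fun y => (g y)^-1)); first exact: fc.
  have gxn0 : g x != 0 by rewrite gt_eqF.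
  exact: (@continuous_comp _ _ _ g GRing.inv x (gc x) (inv_continuous gxn0)).
exists x => [|y yS]; first exact: set_mem.
by rewrite -ler_pdivlMr ?g0 // xmin // mem_set.
Qed.

(** Real coordinates are used because squared norms are polynomials in them,
    though not in the complex entries. *)
Definition entry_cont (R : realType) (T : topologicalType) m n
    (F : T -> 'M[R[i]]_(m, n)) :=
  forall k l, continuous (fun t => complex.Re (F t k l)) /\
              continuous (fun t => complex.Im (F t k l)).

Lemma continuous_add (R : realType) (T : topologicalType) (f g : T -> R) :
  continuous f -> continuous g -> continuous (fun x => f x + g x).
Proof. by move=> fc gc x; apply: (@continuousD _ _ _ f g x (fc x) (gc x)). Qed.

Lemma frob_cont (R : realType) (T : topologicalType) m n
    (F : T -> 'M[R[i]]_(m, n)) :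
  entry_cont F -> continuous (fun t => frob (F t)).
Proof.
move=> Fc; apply: continuous_sum => k; apply: continuous_sum => l.
by have [? ?] := Fc k l; apply: continuous_add; apply: continuous_mul.
Qed.

Lemma schur_adj_cont (R : realType) (T : topologicalType) n
    (G : simple_graph n) (F : T -> 'M[R[i]]_n) :
  entry_cont F -> entry_cont (fun t => schur_mul (F t) (adjmx R[i] G)).
Proof.
move=> Fc k l; have [Rc Ic] := Fc k l.
have E (h : R[i] -> R) : (fun t => h (schur_mul (F t) (adjmx R[i] G) k l)) =
    (fun t => if G k l then h (F t k l) else h 0).
  by apply/funext => t; rewrite schur_adjE; case: (G k l).
by rewrite !E; case: (G k l); split=> //; apply: cst_continuous.
Qed.

Lemma gramE (R : realType) m n (Q : 'M[R[i]]_(m, n)) k l :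
  (Q *m Q^t*) k l =
  (\sum_r (complex.Re (Q k r) * complex.Re (Q l r) +
           complex.Im (Q k r) * complex.Im (Q l r))) +i*
  (\sum_r (complex.Im (Q k r) * complex.Re (Q l r) +
           -1 * (complex.Re (Q k r) * complex.Im (Q l r)))).
Proof.
rewrite mxE; apply/eqP; rewrite eq_complex /= !raddf_sum.
by apply/andP; split; apply/eqP; apply: eq_bigr => r _; rewrite !mxE;
  case: (Q k r) (Q l r) => a b [c d] /=; ring.
Qed.

Lemma gram_cont (R : realType) (T : topologicalType) m n
    (F : T -> 'M[R[i]]_(m, n)) :
  entry_cont F -> entry_cont (fun t => F t *m (F t)^t*).
Proof.
move=> Fc k l.
have E (h : R[i] -> R) := funext (fun t => congr1 h (gramE (F t) k l)).
rewrite !E /=; split; apply: continuous_sum => r.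
all: have [? ?] := Fc k r; have [? ?] := Fc l r.
  by apply: continuous_add; apply: continuous_mul.
apply: continuous_add; first by apply: continuous_mul.
by do 2?[apply: continuous_mul] => //; apply: cst_continuous.
Qed.

Lemma schur_adjZ (R : realType) n (G : simple_graph n) (a : R[i]) (W : 'M_n) :
  schur_mul (a *: W) (adjmx R[i] G) = a *: schur_mul W (adjmx R[i] G).
Proof. by apply/matrixP => k l; rewrite !mxE mulrA. Qed.

(** The minimum of the ratio over the unit sphere of matrices [Q], identified
    with real vectors indexed by row, column and real or imaginary part; an
    arbitrary nonzero [X] is rescaled to the sphere. *)
Lemma gram_ratio_min (R : realType) n (G : simple_graph n) : 'I_n ->
  exists sigma : R, exists Q : 'M[R[i]]_n,
    [/\ 0 < frob (Q *m Q^t*),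
        frob (Q *m Q^t* - schur_mul (Q *m Q^t*) (adjmx R[i] G)) =
          sigma * frob (Q *m Q^t*) &
        forall X : 'M[R[i]]_n, sigma * frob (X *m X^t*) <=
          frob (X *m X^t* - schur_mul (X *m X^t*) (adjmx R[i] G))].
Proof.
move=> k0; pose I : finType := ('I_n * 'I_n * bool)%type.
pose V (x : {ptws I -> R}) : 'M[R[i]]_n :=
  \matrix_(k, l) (x (k, l, true) +i* x (k, l, false)).
pose g x := frob (V x *m (V x)^t*).
pose f x := frob (V x *m (V x)^t*) -
            frob (schur_mul (V x *m (V x)^t*) (adjmx R[i] G)).
have VE (h : R[i] -> R) k l := funext
  (fun x : {ptws I -> R} => congr1 h (mxE matrix_key
     (fun k l => x (k, l, true) +i* x (k, l, false)) k l)).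
have Vc : entry_cont V.
  by move=> k l; rewrite /V !VE /=; split; apply: coord_cont.
have gc : continuous g by apply: frob_cont; apply: gram_cont.
have fc : continuous f.
  move=> x; apply: (@continuousB _ _ _ g _ x (gc x)).
  by apply: frob_cont; apply: schur_adj_cont; apply: gram_cont.
have frobV x : frob (V x) = \sum_a x a * x a.
  have -> : \sum_a x a * x a =
      \sum_(a : I) x (a.1.1, a.1.2, a.2) * x (a.1.1, a.1.2, a.2).
    by apply: eq_bigr => -[[k l] b].
  rewrite -(pair_bigA _ (fun kl b => x (kl.1, kl.2, b) * x (kl.1, kl.2, b))) /=.
  rewrite -(pair_bigA _ (fun k l => \sum_b x (k, l, b) * x (k, l, b))) /=.
  apply: eq_bigr => k _; apply: eq_bigr => l _; rewrite !mxE /=.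
  by rewrite big_bool.
have gram_gt0 (X : 'M[R[i]]_n) : 0 < frob X -> 0 < frob (X *m X^t*).
  move=> X0; rewrite lt_neqAle frob_ge0 andbT eq_sym frob_eq0.
  (* [|X|^2] is the trace of the Gram matrix. *)
  by apply: contraTneq X0 => XX; rewrite /frob fdot_tr XX mxtrace0 ltxx.
have g0 x : unit_sphere x -> 0 < g x.
  by move=> xS; apply: gram_gt0; rewrite frobV xS.
have [x xS xmin] := unit_sphere_ratio_min (k0, k0, true) fc gc g0.
exists (f x / g x), (V x); split; first exact: g0.
  by rewrite divfK ?gt_eqF ?g0 // frob_off_adj.
move=> X; have [X0|X0] := eqVneq (frob X) 0.
  move/eqP: X0; rewrite frob_eq0 => /eqP ->; rewrite mul0mx.
  by rewrite (eqP (_ : frob 0 == 0)) ?frob_eq0 // mulr0 frob_ge0.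
have {}X0 : 0 < frob X by rewrite lt_neqAle eq_sym X0 frob_ge0.
(* The factor that puts [X] on the unit sphere. *)
pose s := (Num.sqrt (frob X))^-1.
have s0 : 0 < s by rewrite invr_gt0 sqrtr_gt0.
have s2 : s ^+ 2 * frob X = 1.
  by rewrite exprVn sqr_sqrtr ?frob_ge0 // mulVf // gt_eqF.
pose y : {ptws I -> R} := fun a =>
  s * (if a.2 then complex.Re (X a.1.1 a.1.2) else complex.Im (X a.1.1 a.1.2)).
have Vy : V y = s%:C *: X.
  by apply/matrixP => k l; rewrite !mxE /y /=; case: (X k l) => a b; simpc.
have yS : unit_sphere y by rewrite /unit_sphere /= -frobV Vy frobZ.
have VV : V y *m (V y)^t* = (s ^+ 2)%:C *: (X *m X^t*).
  rewrite Vy linearZ /= map_mxZ -scalemxAl -scalemxAr scalerA.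
  by rewrite [X in _ * X](conjc_real _) -rmorphM.
have := xmin y yS; rewrite {2}/g {2}/f VV schur_adjZ !frobZ -mulrBr.
rewrite frob_off_adj.
by rewrite mulrCA ler_pM2l // !exprn_gt0.
Qed.

(** * The extremal value of the eigenvalue ratio *)

(** Let [P] be the positive part of [M] and [Y = P o A].  Since [M] is supported
    on the edges, [<M, Y> = <M, P> = S^+(M)], whereas [|Y|^2] is at most
    [(1 - sigma) |P|^2 = (1 - sigma) S^+(M)].  Cauchy-Schwarz then gives
    [S^+(M) <= (1 - sigma) |M|^2]. *)
Lemma Sminus_ge (R : realType) n (G : simple_graph n) (sigma : R)
    (W : 'M[R[i]]_n) (M := schur_mul W (adjmx R[i] G)) :
  W \is hermsymmx -> sigma <= 1 ->
  (forall X : 'M[R[i]]_n, sigma * frob (X *m X^t*) <=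
     frob (X *m X^t* - schur_mul (X *m X^t*) (adjmx R[i] G))) ->
  sigma * frob M <= Sminus M.
Proof.
move=> Wh sigma1 sigmaP.
have [SM [Q [QS QD]]] := positive_part (schur_adj_herm G Wh).
rewrite -/M in SM QS QD; have := sigmaP Q; rewrite frob_off_adj.
move: (Q *m Q^t*) QS QD => P PS PD.
have MP : fdot M P = Splus M by have := frobB M P; rewrite PS PD -SM; lra.
set Y := schur_mul P _ => Ysigma.
have MY : fdot M Y = Splus M by rewrite -MP [RHS]fdot_schur_adj.
(* Cauchy-Schwarz for [M] and [Y], before division by [|M|^2]. *)
have := frob_ge0 ((Splus M)%:C *: M - (frob M)%:C *: Y).
rewrite frob_lincomb MY => sq; rewrite PS in Ysigma.
have s0 : 0 <= Splus M by rewrite -PS frob_ge0.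
have t0 : 0 <= Sminus M by rewrite -PD frob_ge0.
move: (Splus M) (Sminus M) (frob M) (frob Y) SM s0 t0 Ysigma sq => s t m y.
move=> SM s0 t0 Ysigma sq.
have [s_eq0|s_neq0] := eqVneq s 0.
  by rewrite -SM s_eq0 add0r -[leRHS]mul1r ler_wpM2r.
have {s_neq0}s0 : 0 < s by rewrite lt_neqAle eq_sym s_neq0.
have m0 : 0 < m by lra.
have ym : s ^+ 2 <= m * y by rewrite -(ler_pM2l m0); nra.
have ms : m * y <= m * (s - sigma * s) by rewrite ler_pM2l //; lra.
have : s * s <= s * (m - sigma * m) by rewrite expr2 in ym; lra.
by rewrite ler_pM2l //; lra.
Qed.

(** The multiple [rho P] is the best approximation of [N] among the multiples of
    [P]; it is the Gram matrix of [sqrt(rho) Q], hence a legitimate competitor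
    in the distance that defines [S^-(N)]. *)
Lemma Sminus_le_witness (R : realType) m n (G : simple_graph n) (rho : R)
    (Q : 'M[R[i]]_(n, m)) (P := Q *m Q^t*) (N := schur_mul P (adjmx R[i] G)) :
  0 <= rho -> frob N = rho * frob P ->
  Sminus N <= (1 - rho) * frob N.
Proof.
move=> rho0 Nrho.
have := @Sminus_le_dist _ _ _ N ((Num.sqrt rho)%:C *: Q)
  (schur_adj_herm G (gram_herm Q)).
have -> : ((Num.sqrt rho)%:C *: Q) *m ((Num.sqrt rho)%:C *: Q)^t* = rho%:C *: P.
  rewrite linearZ /= map_mxZ -scalemxAl -scalemxAr scalerA.
  by rewrite [X in _ * X](conjc_real _) -rmorphM -expr2 sqr_sqrtr.
have := frob_lincomb 1 rho N P; rewrite scale1r => ->.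
rewrite [fdot N P]fdot_schur_adj -/N -/(frob N).
by rewrite Nrho => /le_trans; apply; lra.
Qed.

(** The Gram matrix [n J], with [J] the all-ones matrix, does not vanish on the
    edge [(k, l)], so removing its entries on the edges lowers the norm. *)
Lemma gram_ratio_lt1 (R : realType) n (G : simple_graph n) (sigma : R) k l :
  G k l ->
  (forall X : 'M[R[i]]_n, sigma * frob (X *m X^t*) <=
     frob (X *m X^t* - schur_mul (X *m X^t*) (adjmx R[i] G))) ->
  sigma < 1.
Proof.
move=> Gkl /(_ (const_mx 1)); rewrite frob_off_adj.
set P := const_mx 1 *m _.
have Pkl : P k l = n%:R.
  rewrite mxE (eq_bigr (fun=> 1)) => [|r _]; last by rewrite !mxE rmorph1 mulr1.
  by rewrite sumr_const card_ord.
have n0 : (n > 0)%N by apply: leq_ltn_trans (ltn_ord k).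
have P0 : 0 < frob P.
  rewrite lt_neqAle frob_ge0 andbT eq_sym frob_eq0.
  apply/eqP => /matrixP/(_ k l)/eqP.
  by rewrite Pkl mxE pnatr_eq0 eqn0Ngt n0.
have N0 : 0 < frob (schur_mul P (adjmx R[i] G)).
  rewrite lt_neqAle frob_ge0 andbT eq_sym frob_eq0.
  apply/eqP => /matrixP/(_ k l)/eqP.
  by rewrite schur_adjE Gkl Pkl mxE pnatr_eq0 eqn0Ngt n0.
by move=> le_s; rewrite -(ltr_pM2r P0); lra.
Qed.

Lemma chromatic_coloring n (G : simple_graph n) :
  exists Phi : 'I_n -> 'I_(chromatic_number G),
    forall k l, G k l -> Phi k != Phi l.
Proof.
rewrite /chromatic_number; case: ex_minnP => c /existsP[Phi PhiP] _.
by exists Phi => k l Gkl; exact: (implyP (forallP (forallP PhiP k) l)).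
Qed.

Theorem theorem1p6 (R : realType) (n : nat) (G : simple_graph n)
    (hG : exists k l : 'I_n, G k l) :
  (forall W : 'M[R[i]]_n, admissible G W ->
     0 < Sminus (schur_mul W (adjmx R[i] G))) /\
  exists m : R,
    is_maximum [set eig_ratio G W | W in @admissible R n G] m /\
    m <= (chromatic_number G)%:R.
Proof.
have [k [l Gkl]] := hG; have [Phi PhiG] := chromatic_coloring G.
have [sigma [Q [P0 Qsigma sigmaP]]] := @gram_ratio_min R n G k.
have sigma1 := gram_ratio_lt1 Gkl sigmaP.
have c_sigma : 1 <= (chromatic_number G)%:R * sigma.
  rewrite -(ler_pM2r P0) mul1r -mulrA -Qsigma.
  exact: frob_gram_le_colors PhiG.
have sigma0 : 0 < sigma.
  rewrite ltNge; apply/negP => s0.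
  by have := mulr_ge0_le0 (ler0n R (chromatic_number G)) s0; lra.
have Sminus_gt0 W : admissible G W ->
    sigma * frob (schur_mul W (adjmx R[i] G)) <=
      Sminus (schur_mul W (adjmx R[i] G)) /\
    0 < Sminus (schur_mul W (adjmx R[i] G)).
  move=> [Wh W0]; have le_S := Sminus_ge Wh (ltW sigma1) sigmaP; split=> //.
  apply: lt_le_trans le_S; rewrite mulr_gt0 //.
  by rewrite lt_neqAle eq_sym frob_eq0 W0 frob_ge0.
split=> [W /Sminus_gt0[] //|].
pose P := Q *m Q^t*; pose N := schur_mul P (adjmx R[i] G).
have ratio_le W : admissible G W -> eig_ratio G W <= (1 - sigma) / sigma.
  move=> Wad; have [le_S S0] := Sminus_gt0 W Wad.
  have [SS _] := positive_part (schur_adj_herm G Wad.1).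
  rewrite /eig_ratio /= ler_pdivrMr // mulrAC ler_pdivlMr // -SS in le_S *.
  by lra.
have Nrho : frob N = (1 - sigma) * frob P.
  by have := Qsigma; rewrite frob_off_adj -/P -/N; lra.
have Pad : admissible G P.
  split; first exact: gram_herm.
  by rewrite -frob_eq0 -/N Nrho mulf_neq0 // ?gt_eqF // subr_gt0.
exists ((1 - sigma) / sigma); split; last first.
  by rewrite ler_pdivrMr //; lra.
split=> [|_ [W /ratio_le le_W <-]] //; exists P => //.
apply/le_anti; rewrite ratio_le //=; have [_ S0] := Sminus_gt0 P Pad.
have [SS _] := positive_part (schur_adj_herm G Pad.1).
have rho0 : 0 <= 1 - sigma by lra.
have := Sminus_le_witness rho0 Nrho; rewrite -/N in SS S0 *.
rewrite -SS => le_S.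
by rewrite /eig_ratio /= -/N ler_pdivlMr // mulrAC ler_pdivrMr //; lra.
Qed.
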